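(* For the $m$-point FFT DAG $F_m$ we have $$\mathrm{OPT}_{PRBP}(F_m,r)\ \ge\ \Omega\!\left(\frac{m\log m}{\log r}\right),$$ i.e. there is an absolute constant $c>0$ such that $\mathrm{OPT}_{PRBP}(F_m,r)\ge c\cdot\frac{m\log m}{\log r}$ for every $m\ge 2$ that is a power of $2$ and every integer $r\ge 2$.
   Context: FFT DAG: for $m$ a power of 2, $F_1$ is a single node. For $m\ge 2$, $F_m$ is obtained from two disjoint copies of $F_{m/2}$, whose sinks are labeled $u_1,\dots,u_{m/2}$ (first copy, in order) and $u_{m/2+1},\dots,u_m$ (second copy, in order), by adding new nodes $v_1,\dots,v_m$ and all edges $(u_i,v_j)$ with $i\equiv j \pmod{m/2}$; the sinks of $F_m$ are $v_1,\dots,v_m$ in this order. Partial-computing red-blue pebble game (PRBP, one-shot) on a finite DAG $G=(V,E)$ with fast memory capacity $r$. Sources are nodes of in-degree 0, sinks are nodes of out-degree 0. There are blue, light red and dark red pebbles, and edges can be marked. Initially exactly the sources carry blue pebbles, there are no other pebbles, and all edges are unmarked. Moves: (1) Save: replace a dark red pebble on a node by a blue and a light red pebble. (2) Load: place a light red pebble on a node that has a blue pebble. (3) Partial compute: for an unmarked edge $(u,v)$ such that (i) all incoming edges of $u$ are marked, (ii) $u$ has a (light or dark) red pebble, and (iii) $v$ has a (light or dark) red pebble or no pebble at all, replace all pebbles on $v$ by one dark red pebble and mark $(u,v)$ (each edge is marked at most once and never unmarked). (4) Delete: remove a light red pebble from any node, or remove a dark red pebble from a non-sink node all of whose outgoing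 edges are marked. At every time the total number of (light and dark) red pebbles is at most $r$. A pebbling is a sequence of moves after which every sink has a blue pebble and every edge is marked. Its cost is the total number of save and load moves, and $\mathrm{OPT}_{PRBP}(G,r)$ is the minimum cost of a pebbling of $G$ with capacity $r$. *)

(* Defs.v *)
From HB Require Import structures.
From mathcomp Require Import all_boot all_order all_algebra.

Set Implicit Arguments.
Unset Strict Implicit.
Unset Printing Implicit Defensive.

Import Order.TTheory GRing.Theory Num.Theory.

(* The game is defined for an arbitrary finite digraph (V, E): its rules do not
   refer to acyclicity.  That the FFT digraph is acyclic is [fft_acyclic]. *)
Definition source (V : finType) (E : rel V) (v : V) : bool :=
  [forall u, ~~ E u v].

Definition sink (V : finType) (E : rel V) (v : V) : bool :=
  [forall w, ~~ E v w].

Definition acyclic (V : finType) (E : rel V) : Prop :=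
  forall (x : V) (p : seq V), path E x p -> last x p = x -> p = [::].

Record config (V : finType) := Config {
  blue : {set V};
  light : {set V};
  dark : {set V};
  marked : {set V * V}
}.

Inductive move (V : finType) :=
  | SaveAt of V
  | LoadAt of V
  | Compute of V & V
  | DeleteLight of V
  | DeleteDark of V.

Definition red (V : finType) (c : config V) : {set V} := light c :|: dark c.

Definition initial (V : finType) (E : rel V) : config V :=
  Config [set v | source E v] set0 set0 set0.

Definition in_marked (V : finType) (E : rel V) (c : config V) (v : V) : bool :=
  [forall u, E u v ==> ((u, v) \in marked c)].

Definition out_marked (V : finType) (E : rel V) (c : config V) (v : V) : bool :=
  [forall w, E v w ==> ((v, w) \in marked c)].

Definition legal (V : finType) (E : rel V) (c : config V) (mv : move V) : bool :=
  match mv with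
  | SaveAt v => v \in dark c
  | LoadAt v => v \in blue c
  | Compute u v =>
      [&& E u v, (u, v) \notin marked c, in_marked E c u, u \in red c
        & (v \in red c) || (v \notin blue c)]
  | DeleteLight v => v \in light c
  | DeleteDark v => [&& v \in dark c, ~~ sink E v & out_marked E c v]
  end.

Definition exec (V : finType) (c : config V) (mv : move V) : config V :=
  match mv with
  | SaveAt v => Config (v |: blue c) (v |: light c) (dark c :\ v) (marked c)
  | LoadAt v => Config (blue c) (v |: light c) (dark c) (marked c)
  | Compute u v =>
      Config (blue c :\ v) (light c :\ v) (v |: dark c) ((u, v) |: marked c)
  | DeleteLight v => Config (blue c) (light c :\ v) (dark c) (marked c)
  | DeleteDark v => Config (blue c) (light c) (dark c :\ v) (marked c)
  end.

Definition within (V : finType) (r : nat) (c : config V) : bool :=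
  #|light c| + #|dark c| <= r.

Definition complete (V : finType) (E : rel V) (c : config V) : bool :=
  [forall v, sink E v ==> (v \in blue c)]
  && [forall u, forall v, E u v ==> ((u, v) \in marked c)].

Fixpoint pebbling_from (V : finType) (E : rel V) (r : nat) (c : config V)
    (s : seq (move V)) : bool :=
  within r c &&
  (if s is mv :: s' then legal E c mv && pebbling_from E r (exec c mv) s'
   else complete E c).

Definition pebbling (V : finType) (E : rel V) (r : nat) (s : seq (move V)) : bool :=
  pebbling_from E r (initial E) s.

Definition is_io (V : finType) (mv : move V) : bool :=
  match mv with SaveAt _ | LoadAt _ => true | _ => false end.

Definition cost (V : finType) (s : seq (move V)) : nat := count (@is_io V) s.

(* Nodes of F_(2^k): for k.+1, the two copies of F_(2^k) (left summand) and the
   new nodes v_j.  All indices are 0-based. *)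
Fixpoint fft_node (k : nat) : finType :=
  match k with
  | 0 => unit
  | k'.+1 => ((fft_node k' + fft_node k') + 'I_(2 ^ k'.+1))%type
  end.

Definition fft_sink (k : nat) : 'I_(2 ^ k) -> fft_node k :=
  match k with
  | 0 => fun _ => tt
  | k'.+1 => fun j => inr j
  end.

(* In F_(2^k'.+1) the i-th sink of the first copy is u_i and the i-th sink of
   the second copy is u_(2^k' + i). *)
Fixpoint fft_edge (k : nat) : rel (fft_node k) :=
  match k with
  | 0 => fun _ _ => false
  | k'.+1 => fun x y =>
      match x, y with
      | inl (inl a), inl (inl b) => fft_edge a b
      | inl (inr a), inl (inr b) => fft_edge a b
      | inl (inl a), inr j =>
          [exists i : 'I_(2 ^ k'), (a == fft_sink i) && (i == j %[mod 2 ^ k'])]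
      | inl (inr a), inr j =>
          [exists i : 'I_(2 ^ k'),
             (a == fft_sink i) && (2 ^ k' + i == j %[mod 2 ^ k'])]
      | _, _ => false
      end
  end.

Fixpoint fft_level (k : nat) : fft_node k -> nat :=
  match k with
  | 0 => fun _ => 0
  | k'.+1 => fun x =>
      match x with
      | inl (inl a) => fft_level a
      | inl (inr a) => fft_level a
      | inr _ => k'.+1
      end
  end.

Lemma fft_level_le k (x : fft_node k) : fft_level x <= k.
Proof. by elim: k x => [|k IH] //= [[x|x]|j] //; exact: leqW. Qed.

Lemma fft_edge_level k (x y : fft_node k) :
  fft_edge x y -> fft_level x < fft_level y.
Proof.
elim: k x y => [|k IH] //= [[x|x]|i] [[y|y]|j] //=; try exact: IH.
- by rewrite ltnS fft_level_le.
- by rewrite ltnS fft_level_le.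
Qed.

Lemma fft_acyclic k : acyclic (@fft_edge k).
Proof.
move=> x [|y p] //= /andP[/fft_edge_level xy yp] eq_last; exfalso.
suff le_last : fft_level y <= fft_level (last y p).
  by move: (leq_trans xy le_last); rewrite eq_last ltnn.
elim: p y yp {xy eq_last} => [|z p IH] y //= /andP[/fft_edge_level yz zp].
exact: leq_trans (ltnW yz) (IH _ zp).
Qed.

From mathcomp Require Import all_classical all_reals all_analysis.

(* The minimum cost; as costs are naturals, the infimum is attained whenever a
   pebbling exists, which for acyclic E is the case as soon as 2 <= r (it is +oo
   if there is no pebbling at all). *)
Definition OPT_PRBP (R : realType) (V : finType) (E : rel V) (r : nat) : \bar R :=
  ereal_inf [set x : \bar R |
    exists2 s : seq (move V), pebbling E r s & x = ((cost s)%:R%R)%:E].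

(* Main.v *)
(* Cut a pebbling into segments of r I/O moves.  A node whose first outgoing
   edge is marked during a segment was red when the segment began, or was loaded
   during it, or had all its incoming edges marked within the segment; indeed a
   partially computed node keeps a pebble until its outgoing edges are marked.
   So these nodes are dominated by a set D of at most 2r nodes.  In the FFT, a set
   dominated by d <= 2^L nodes has at most d (2L + 1) elements: with d_1, d_2, d_3
   elements of D in the two copies and on the top level, the top level contributes
   at most d_3 + 2 min(d_1, d_2), and the smaller of d_1, d_2 is at most 2^(L-1).
   Since all m log m non-sinks have to be used, this bounds the number of segments
   from below when r <= m; the last, incomplete segment is absorbed by the bound
   cost >= m that comes from saving the sinks, which is also enough when r > m. *)

Require Import Defs.
From mathcomp Require Import all_boot zify.

Set Implicit Arguments.
Unset Strict Implicit.
Unset Printing Implicit Defensive.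

(** * Dominated sets and the invariants of the game *)

(** Requiring some predecessor forces the sources of [U] into [D], so every path from a source to a
    node of [U] meets [D]. *)
Definition dominated (V : finType) (E : rel V) (D U : {set V}) : Prop :=
  forall u, u \in U ->
    u \in D \/ (exists p, E p u) /\ (forall p, E p u -> p \in U).

Definition active (V : finType) (M : {set V * V}) : {set V} :=
  [set u | [exists w, (u, w) \in M]].

Section Game.

Variables (V : finType) (E : rel V).
Implicit Types (c : config V) (mv : move V) (s : seq (move V)).

(** By [marked_pebbled] and [marked_in], a node with some but not all incoming edges marked cannot
    be without a pebble. *)
Record reachable_inv c : Prop := ReachableInv {
  light_blue : light c \subset blue c;
  marked_in : forall v w, (v, w) \in marked c -> in_marked E c v;
  marked_pebbled : forall u v, (u, v) \in marked c ->
    [|| v \in red c, v \in blue c | v \in active (marked c)] }.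

(* [M0] is the set of edges marked at the start of the segment and [D] consists
   of the nodes that were red at that time or have been loaded since. *)
Record segment_inv (M0 : {set V * V}) (D : {set V}) c : Prop := SegmentInv {
  segment_reachable : reachable_inv c;
  segment_marked : M0 \subset marked c;
  segment_red : forall v, v \in red c ->
    v \in D \/ (exists p, E p v) /\ (forall p, (p, v) \notin M0);
  segment_dominated : dominated E D (active (marked c :\: M0)) }.

Lemma activeP (M : {set V * V}) u :
  reflect (exists w, (u, w) \in M) (u \in active M).
Proof. by rewrite inE; apply: existsP. Qed.

Lemma activeS (M M' : {set V * V}) : M \subset M' -> active M \subset active M'.
Proof.
move=> /subsetP sM; apply/subsetP=> u /activeP[w /sM uw].
by apply/activeP; exists w.
Qed.

Lemma in_markedP c v :
  reflect (forall u, E u v -> (u, v) \in marked c) (in_marked E c v).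
Proof.
apply: (iffP forallP) => h u; first by move/(implyP (h u)).
by apply/implyP/h.
Qed.

Lemma in_markedS c c' v :
  marked c \subset marked c' -> in_marked E c v -> in_marked E c' v.
Proof.
by move=> /subsetP sM /in_markedP h; apply/in_markedP=> u /h /sM.
Qed.

Lemma dominatedS (D D' U : {set V}) :
  D \subset D' -> dominated E D U -> dominated E D' U.
Proof. by move=> /subsetP sD h u /h[/sD uD | uE]; [left | right]. Qed.

Lemma reachable_inv_initial : reachable_inv (initial E).
Proof. by split=> [|v w|u v] /=; rewrite ?sub0set ?in_set0. Qed.

(** A deleted light pebble leaves a blue one behind, and a dark one is deleted only from a non-sink
    with all outgoing edges marked, which is therefore active. *)
Lemma reachable_inv_exec c mv :
  reachable_inv c -> legal E c mv -> reachable_inv (exec c mv).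
Proof.
case=> /subsetP LB MI MP; case: mv => [x|x|x y|x|x] /=.
- move=> xD; split=> [|//|u v /MP] /=.
    by apply: setUS; apply/subsetP.
  by rewrite /red !inE; case: eqP => //= _; rewrite orbT.
- move=> xB; split=> [|//|u v /MP] /=.
    by apply/subsetP=> v; rewrite !inE => /orP[/eqP->|/LB].
  by rewrite /red !inE -!orbA => ->; rewrite orbT.
- move=> /and5P[Exy nxy xin xr yr].
  have sM : marked c \subset marked (exec c (Compute x y)) by apply: subsetUr.
  split=> [|v w|u v] /=.
  + by apply/subsetP=> v; rewrite !inE => /andP[-> /LB].
  + by rewrite !inE => /predU1P[[-> _]|/MI]; apply: (in_markedS sM).
  + case: (v =P y) => [-> _|/eqP nvy]; first by rewrite /red !inE eqxx orbT.
    rewrite in_setU1 xpair_eqE (negbTE nvy) andbF /= => /MP.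
    case/or3P => [||/(subsetP (activeS sM))].
    * by rewrite /red /= !inE nvy => /orP[->|->]; rewrite ?orbT.
    * by rewrite !inE nvy => ->; rewrite !orbT.
    * by move=> ->; rewrite !orbT.
- move=> xL; split=> [|//|u v /MP] /=.
    by apply/subsetP=> v; rewrite !inE => /andP[_ /LB].
  case/or3P; rewrite /red /= !inE; last by move=> ->; rewrite !orbT.
  + by case/orP=> [/LB|] ->; rewrite !orbT.
  + by move=> ->; rewrite !orbT.
- move=> /and3P[xD /forallPn[w /negPn Exw] /forallP xo].
  split=> [||u v /MP] /=; [exact/subsetP | exact: MI |].
  case: (v =P x) => [-> _|/eqP nvx].
    apply/or3P/Or33/activeP; exists w; exact: (implyP (xo w)).
  by rewrite /red !inE nvx.
Qed.

Lemma segment_inv_start c : reachable_inv c -> segment_inv (marked c) (red c) c.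
Proof.
move=> I; split=> // [v|u]; first by left.
by case/activeP=> w; rewrite setDv inE.
Qed.

Lemma segment_inv_exec M0 D c mv :
  segment_inv M0 D c -> legal E c mv ->
  segment_inv M0 (if mv is LoadAt v then v |: D else D) (exec c mv).
Proof.
case=> I sM0 R Dom lg; have I' := reachable_inv_exec I lg.
case: mv lg I' => [x|x|x y|x|x] /=.
- move=> xD I'; split=> // v; rewrite /red /= !inE.
  case: (v =P x) => [-> _|_] /=; last by move=> h; apply: R; rewrite !inE.
  by apply: R; rewrite !inE xD orbT.
- move=> xB I'; split=> // [v|]; last by apply: dominatedS Dom; apply: subsetUr.
  rewrite /red /= !inE -orbA; case: (v =P x) => [-> _|_] /=; first by left.
  by move=> h; apply: R; rewrite !inE.
- move=> /and5P[Exy nxy xin xr yr] I'; split=> //=.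
  + by apply: subset_trans sM0 _; apply: subsetUr.
  + move=> v; rewrite /red /= !inE.
    case: (v =P y) => [-> _|_] /=; last by move=> h; apply: R; rewrite !inE.
    case yred: (y \in red c) yr => /= yr; first exact: R.
    right; split=> [|p]; first by exists x.
    (* Had an edge into the pebble-free [y] been marked before the segment, [y] would be active and
       all its incoming edges marked, but [(x, y)] is not. *)
    apply/negP=> /(subsetP sM0) /(marked_pebbled I).
    rewrite yred (negbTE yr) /= => /activeP[w /(marked_in I) /in_markedP].
    by move=> /(_ _ Exy); rewrite (negbTE nxy).
  + have sA : active (marked c :\: M0) \subset active (((x, y) |: marked c) :\: M0).
      by apply/activeS/setSD/subsetUr.
    move=> u /activeP[w]; rewrite !inE => /andP[nuw /predU1P[[-> ew]|uw]].
      case: (R x xr) => [|[xs nx]]; first by left.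
      (* All edges into [x] are marked by now and none is in [M0], so every predecessor of [x]
         became active within the segment. *)
      right; split=> // p Epx; apply: (subsetP sA); apply/activeP; exists x.
      by rewrite inE nx /=; move/in_markedP: xin; apply.
    have /Dom[|[us up]] : u \in active (marked c :\: M0).
      by apply/activeP; exists w; rewrite inE nuw.
    + by left.
    + by right; split=> // p /up /(subsetP sA).
- move=> xL I'; split=> // v; rewrite /red /= !inE => h.
  by apply: R; rewrite !inE; case/orP: h => [/andP[_]|] ->; rewrite ?orbT.
- move=> xD I'; split=> // v; rewrite /red /= !inE => h.
  by apply: R; rewrite !inE; case/orP: h => [|/andP[_]] ->; rewrite ?orbT.
Qed.

(** * Cutting a pebbling into segments *)

Fixpoint legal_run c s : bool :=
  if s is mv :: s' then legal E c mv && legal_run (exec c mv) s' else true.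

Lemma segment_inv_run M0 D c s :
  segment_inv M0 D c -> legal_run c s ->
  exists2 D' : {set V},
    #|D'| <= #|D| + cost s & segment_inv M0 D' (foldl (@exec V) c s).
Proof.
elim: s c D => [|mv s IH] c D S /=; first by exists D; rewrite ?leq_addr.
case/andP=> /(segment_inv_exec S) S' /(IH _ _ S')[D' leD' ?]; exists D' => //.
apply: leq_trans leD' _; rewrite /cost /= addnA leq_add2r.
by case: (mv) => [x|x|x y|x|x] /=; rewrite ?leq_addr // cardsU1; lia.
Qed.

Lemma pebbling_from_cat r c s1 s2 :
  pebbling_from E r c (s1 ++ s2) ->
  legal_run c s1 && pebbling_from E r (foldl (@exec V) c s1) s2.
Proof.
by elim: s1 c => [|mv s1 IH] c //= /and3P[_ -> /IH].
Qed.

Lemma pebbling_from_within r c s : pebbling_from E r c s -> within r c.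
Proof. by case: s => [|mv s] /= /andP[]. Qed.

Lemma pebbling_from_legal r c s :
  pebbling_from E r c s -> legal_run c s /\ complete E (foldl (@exec V) c s).
Proof.
move=> h; have := @pebbling_from_cat r c s [::]; rewrite cats0 => /(_ h).
by case/and3P.
Qed.

(** Each move costs at most one, so the running cost skips no value. *)
Lemma cost_split r s :
  cost s <= r \/ exists s1 s2, s = s1 ++ s2 /\ cost s1 = r.
Proof.
elim: s r => [|mv s IH] r; first by left.
case: r => [|r]; first by right; exists [::], (mv :: s).
rewrite /cost /=; case io: (is_io mv).
  case: (IH r) => [|[s1 [s2 [-> <-]]]]; first by left; rewrite add1n.
  by right; exists (mv :: s1), s2; rewrite /cost /= io.
case: (IH r.+1) => [|[s1 [s2 [-> h]]]]; first by left.
by right; exists (mv :: s1), s2; rewrite -h /cost /= io.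
Qed.

(** At most [r] nodes are red at the start and at most [r] are loaded, hence the size [r.*2]; [K]
    bounds the growth from [D] to a set it dominates. *)
Lemma active_run_bound r K c s :
  (forall D U, dominated E D U -> #|D| <= r.*2 -> #|U| <= r.*2 * K) ->
  reachable_inv c -> within r c -> legal_run c s -> cost s <= r ->
  reachable_inv (foldl (@exec V) c s) /\
  #|active (marked (foldl (@exec V) c s))| <= #|active (marked c)| + r.*2 * K.
Proof.
move=> HK I w lg le_r.
have [D' leD' S] := segment_inv_run (segment_inv_start I) lg.
set c' := foldl _ _ _ in S *; split; first exact: segment_reachable S.
have sA : active (marked c') \subset
          active (marked c) :|: active (marked c' :\: marked c).
  apply/subsetP=> u /activeP[v uv]; rewrite inE.
  case uv0: ((u, v) \in marked c); apply/orP; [left|right]; apply/activeP.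
    by exists v.
  by exists v; rewrite inE uv0.
apply: leq_trans (subset_leq_card sA) (leq_trans (leq_card_setU _ _) _).
rewrite leq_add2l; apply: HK (segment_dominated S) _.
have : #|red c| <= r by apply: leq_trans w; exact: leq_card_setU.
by move: leD'; lia.
Qed.

(** Induction on the cost, removing a segment of cost [r] each time. The summand [r] pays for the
    last segment, after which every non-sink is active. *)
Lemma active_pebbling_bound r K c s :
  (forall D U, dominated E D U -> #|D| <= r.*2 -> #|U| <= r.*2 * K) ->
  0 < r -> reachable_inv c -> pebbling_from E r c s ->
  #|[set v | ~~ sink E v]| <= #|active (marked c)| + (cost s + r).*2 * K.
Proof.
move=> HK r_gt0; have [n] := ubnP (cost s); elim: n s c => // n IH s c.
move=> lt_n I pb; have w := pebbling_from_within pb.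
case: (cost_split r s) => [le_r|[s1 [s2 [es c1]]]].
  have [lg /andP[_ /forallP cmp]] := pebbling_from_legal pb.
  have [_ le_act] := active_run_bound HK I w lg le_r.
  have sA : [set v | ~~ sink E v] \subset
            active (marked (foldl (@exec V) c s)).
    apply/subsetP=> u; rewrite inE => /forallPn[v /negPn Euv].
    by apply/activeP; exists v; move/forallP: (cmp u) => /(_ v) /implyP; apply.
  apply: leq_trans (subset_leq_card sA) (leq_trans le_act _).
  by rewrite leq_add2l leq_mul2r; lia.
move: pb; rewrite es => /pebbling_from_cat /andP[lg pb2].
have [I' le_act] := active_run_bound HK I w lg (eq_leq c1).
have cs : cost s = r + cost s2 by rewrite es /cost count_cat -/(cost s1) c1.
have := IH s2 _ _ I' pb2; rewrite -es cs => /(_ ltac:(lia)).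
by move: le_act; rewrite !doubleD !mulnDl; lia.
Qed.

(** Only a save creates a blue pebble, and only one, so each node of [S] not blue at the start needs
    its own save. *)
Lemma blue_sinks_run (S : {set V}) r c s :
  pebbling_from E r c s -> S \subset [set v | sink E v] ->
  #|S| <= #|S :&: blue c| + cost s.
Proof.
move=> + /subsetP sS; elim: s c => [|mv s IH] c /=.
  case/and3P=> _ /forallP cb _; rewrite addn0; apply/subset_leq_card/subsetP=> v vS.
  by rewrite inE vS; apply: (implyP (cb v)); have := sS v vS; rewrite inE.
case/and3P=> _ lg /IH /leq_trans; apply.
rewrite /cost /= addnA leq_add2r.
case: (mv) => [x|x|x y|x|x] /=; rewrite ?addn0 ?leq_addr //.
  rewrite setIUr; apply: leq_trans (leq_card_setU _ _) _.
  by rewrite addnC leq_add2l (leq_trans (subset_leq_card (subsetIr _ _))) ?cards1.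
by apply/subset_leq_card/setIS/subsetDl.
Qed.

End Game.

(** * Dominated sets in the FFT graph *)

Lemma card_set_sum (T1 T2 : finType) (A : {set T1 + T2}) :
  #|A| = #|[set x | inl x \in A]| + #|[set y | inr y \in A]|.
Proof.
rewrite -!sum1_card big_sumType /=.
by congr (_ + _); apply: eq_bigl => x; rewrite inE.
Qed.

(** Sinks are recorded by index so that those of the two copies can be intersected. *)
Definition sinks_in k (U : {set fft_node k}) : {set 'I_(2 ^ k)} :=
  [set i | fft_sink i \in U].

Section FFT.

Variable k : nat.
Notation lft x := (inl (inl x) : fft_node k.+1).
Notation rgt x := (inl (inr x) : fft_node k.+1).
Notation top j := (inr j : fft_node k.+1).
Implicit Types D U : {set fft_node k.+1}.

Definition lft_part U : {set fft_node k} := [set x | lft x \in U].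
Definition rgt_part U : {set fft_node k} := [set x | rgt x \in U].

Lemma card_parts U : #|U| = #|lft_part U| + #|rgt_part U| + #|sinks_in U|.
Proof.
rewrite card_set_sum card_set_sum.
by congr (_ + _ + _); apply: eq_card => x; rewrite !inE.
Qed.

Lemma mod_fft_subproof (j : 'I_(2 ^ k.+1)) : j %% 2 ^ k < 2 ^ k.
Proof. by rewrite ltn_mod expn_gt0. Qed.

Definition mod_fft j := Ordinal (mod_fft_subproof j).

Lemma fft_edge_lft_top j : fft_edge (lft (fft_sink (mod_fft j))) (top j).
Proof. by apply/existsP; exists (mod_fft j); rewrite eqxx /= modn_mod. Qed.

Lemma fft_edge_rgt_top j : fft_edge (rgt (fft_sink (mod_fft j))) (top j).
Proof.
by apply/existsP; exists (mod_fft j); rewrite eqxx /= modnDl modn_mod.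
Qed.

(** No edge enters a copy from outside, so domination restricts to it. *)
Lemma dominated_lft D U :
  dominated (@fft_edge k.+1) D U ->
  dominated (@fft_edge k) (lft_part D) (lft_part U).
Proof.
move=> dom u; rewrite !inE => /dom[uD|[[[[p|p]|p] //= pu] up]]; [by left|right].
by split=> [|q qu]; [exists p | rewrite inE; apply: up].
Qed.

Lemma dominated_rgt D U :
  dominated (@fft_edge k.+1) D U ->
  dominated (@fft_edge k) (rgt_part D) (rgt_part U).
Proof.
move=> dom u; rewrite !inE => /dom[uD|[[[[p|p]|p] //= pu] up]]; [by left|right].
by split=> [|q qu]; [exists p | rewrite inE; apply: up].
Qed.

(** A top node of [U] outside [D] has both predecessors in [U]. They share one index, which lies in
    [SA :&: SB]. *)
Lemma card_dominated_top D U :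
  dominated (@fft_edge k.+1) D U ->
  #|sinks_in U| <= #|sinks_in D| +
    (minn #|sinks_in (lft_part U)| #|sinks_in (rgt_part U)|).*2.
Proof.
move=> dom; set SA := sinks_in (lft_part U); set SB := sinks_in (rgt_part U).
(* The half containing [j] and its residue determine [j], so each common index serves at most two
   top nodes. *)
pose f (j : 'I_(2 ^ k.+1)) := (j < 2 ^ k, mod_fft j).
have f_inj : injective f.
  move=> i j [lt_ij eq_ij]; apply: val_inj => /=.
  have dv x : x < 2 ^ k.+1 -> x %/ 2 ^ k = ~~ (x < 2 ^ k).
    rewrite expnS; case: (ltnP x (2 ^ k)) => [/divn_small -> //|le_x lt_x].
    rewrite -(subnK le_x) divnDr // divnn expn_gt0 divn_small //; lia.
  by rewrite (divn_eq i (2 ^ k)) (divn_eq j (2 ^ k)) !dv // lt_ij eq_ij.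
have sub : sinks_in U \subset
  sinks_in D :|: f @^-1: setX [set: bool] (SA :&: SB).
  apply/subsetP=> j; rewrite !inE => /dom[-> //|[_ up]].
  by rewrite up ?fft_edge_lft_top // up ?fft_edge_rgt_top ?orbT.
apply: leq_trans (subset_leq_card sub) (leq_trans (leq_card_setU _ _) _).
rewrite leq_add2l -(card_imset _ f_inj).
apply: leq_trans (_ : #|setX [set: bool] (SA :&: SB)| <= _).
  by apply/subset_leq_card/subsetP=> y /imsetP[j]; rewrite !inE => jS ->.
rewrite cardsX cardsT card_bool mul2n leq_double leq_min.
by rewrite !subset_leq_card ?subsetIl ?subsetIr.
Qed.

End FFT.

Lemma dominated0 (D U : {set fft_node 0}) :
  dominated (@fft_edge 0) D U -> U \subset D.
Proof. by move=> dom; apply/subsetP=> u /dom[|[[]]]. Qed.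

(** Twice the minimum is at most the sum, so the contributions of the two copies and of the top
    level add up to at most [#|D|]. *)
Lemma card_dominated_sinks k (D U : {set fft_node k}) :
  dominated (@fft_edge k) D U -> #|sinks_in U| <= #|D|.
Proof.
elim: k D U => [|k IH] D U dom.
  have sU := subset_leq_card (dominated0 dom); apply: leq_trans sU.
  rewrite -(card_imset (f := @fft_sink 0)); last first.
    by move=> i j _; apply: val_inj; case: i j => [[]//] ? [[]].
  by apply/subset_leq_card/subsetP=> x /imsetP[i]; rewrite inE => iU ->.
have := card_dominated_top dom.
have := IH _ _ (dominated_lft dom); have := IH _ _ (dominated_rgt dom).
rewrite (card_parts D); lia.
Qed.

Lemma card_dominated k L (D U : {set fft_node k}) :
  dominated (@fft_edge k) D U -> #|D| <= 2 ^ L -> #|U| <= #|D| * L.*2.+1.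
Proof.
elim: k L D U => [|k IH] L D U dom.
  by move=> _; apply: leq_trans (subset_leq_card (dominated0 dom)) (leq_pmulr _ _).
have domA := dominated_lft dom; have domB := dominated_rgt dom.
have := card_dominated_top dom.
have := card_dominated_sinks domA; have := card_dominated_sinks domB.
rewrite (card_parts D) (card_parts U).
have leA L' := IH L' _ _ domA; have leB L' := IH L' _ _ domB.
move: leA leB.
set a := #|lft_part D|; set b := #|rgt_part D|; set d := #|sinks_in D|.
set p := #|lft_part U|; set q := #|rgt_part U|; set t := #|sinks_in U|.
move=> leA leB sB sA le_t le_D.
(* For exponent 0, [D] has at most one node, so one of [a], [b] vanishes and the top level gains
   nothing beyond [d]. *)
case: L le_D => [|L] le_D.
  by have := leA 0; have := leB 0; rewrite expn0 !muln1 in le_D *; lia.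
(* The copy with the smaller share of [D] admits exponent [L]. This saves twice its share, exactly
   what the top level may add. *)
have := leA L; have := leA L.+1; have := leB L; have := leB L.+1.
rewrite !doubleS !mulnS !mulnDl expnS in le_D *.
move: (a * L.*2) (b * L.*2) (d * L.*2) => aL bL dL.
lia.
Qed.

(** * Node counts and cost bounds over the integers *)

Lemma card_fft_node k : #|fft_node k| = k.+1 * 2 ^ k.
Proof.
elim: k => [|k IH]; first by rewrite card_unit.
by rewrite !card_sum IH card_ord expnS; nia.
Qed.

Lemma fft_sink_or_out k (x : fft_node k) :
  (exists i, x = fft_sink i) \/ exists y, fft_edge x y.
Proof.
elim: k x => [|k IH] x.
  by left; exists ord0; case: x.
have w i : i < 2 ^ k -> i < 2 ^ k.+1.
  by move=> lt_i; rewrite expnS; lia.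
case: x => [[x|x]|j]; last by left; exists j.
- right; case: (IH x) => [[i ->]|[y xy]]; last by exists (inl (inl y)).
  exists (inr (Ordinal (w i (ltn_ord i)))); apply/existsP; exists i.
  by rewrite !eqxx.
- right; case: (IH x) => [[i ->]|[y xy]]; last by exists (inl (inr y)).
  exists (inr (Ordinal (w i (ltn_ord i)))); apply/existsP; exists i.
  by rewrite eqxx /= modnDl.
Qed.

(** Every node of the two copies has an outgoing edge, and together they form [k.+1] levels of
    [2 ^ k.+1] nodes. *)
Lemma card_fft_nonsink k :
  k.+1 * 2 ^ k.+1 <= #|[set v | ~~ sink (@fft_edge k.+1) v]|.
Proof.
have inl_inj : injective (inl : _ -> fft_node k.+1) by move=> x y [].
rewrite (_ : k.+1 * _ = #|[set: fft_node k + fft_node k]|); last first.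
  by rewrite cardsT card_sum card_fft_node expnS; nia.
rewrite -(card_imset _ inl_inj); apply/subset_leq_card/subsetP=> _ /imsetP[x _ ->].
rewrite inE; apply/forallPn.
case: (fft_sink_or_out (inl x : fft_node k.+1)) => [[]|[y xy]] //.
by exists y; apply/negPn.
Qed.

(** The top nodes are sinks but not sources, so each has to be saved. *)
Lemma fft_cost_sinks k r s :
  pebbling (@fft_edge k.+1) r s -> 2 ^ k.+1 <= cost s.
Proof.
move=> pb; pose S : {set fft_node k.+1} := inr @: [set: 'I_(2 ^ k.+1)].
have inr_inj : injective (inr : _ -> fft_node k.+1) by move=> x y [].
have <- : #|S| = 2 ^ k.+1 by rewrite card_imset // cardsT card_ord.
have sS : S \subset [set v | sink (@fft_edge k.+1) v].
  apply/subsetP=> _ /imsetP[j _ ->]; rewrite inE.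
  by apply/forallP=> -[[x|x]|i].
apply: leq_trans (blue_sinks_run pb sS) _.
rewrite (_ : S :&: _ = set0) ?cards0 //; apply/eqP.
rewrite -subset0; apply/subsetP=> _ /setIP[/imsetP[j _ ->]].
rewrite inE => /forallP /(_ (inl (inl (fft_sink (mod_fft j))))).
by rewrite fft_edge_lft_top.
Qed.

Lemma fft_cost_active k L r s :
  0 < r -> r.*2 <= 2 ^ L -> pebbling (@fft_edge k.+1) r s ->
  k.+1 * 2 ^ k.+1 <= (cost s + r).*2 * L.*2.+1.
Proof.
move=> r_gt0 le_r pb; apply: leq_trans (card_fft_nonsink k) _.
have HK (D U : {set fft_node k.+1}) :
    dominated (@fft_edge k.+1) D U -> #|D| <= r.*2 -> #|U| <= r.*2 * L.*2.+1.
  move=> dom le_D; apply: leq_trans (card_dominated dom (leq_trans le_D le_r)) _.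
  by rewrite leq_mul2r le_D orbT.
have := active_pebbling_bound HK r_gt0 (reachable_inv_initial _) pb.
rewrite (_ : active _ = set0) ?cards0 //; apply/eqP.
by rewrite -subset0; apply/subsetP=> u /activeP[w] /=; rewrite !in_set0.
Qed.

Lemma fft_cost_log k r s :
  2 <= r <= 2 ^ k.+1 -> pebbling (@fft_edge k.+1) r s ->
  k.+1 * 2 ^ k.+1 <= 28 * cost s * trunc_log 2 r.
Proof.
move=> /andP[r_ge2 le_r] pb; set t := trunc_log 2 r.
have t_gt0 : 0 < t by rewrite trunc_log_gt0.
have le_2r : r.*2 <= 2 ^ t.+2.
  have := trunc_log_ltn r (isT : 1 < 2).
  by rewrite -/t (expnS 2 t.+1); lia.
(* The constant is 28 = 4 * 7: [r <= 2 ^ k.+1 <= cost s] bounds the first factor by [4 * cost s],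
   and [2 (t + 2) + 1 <= 7 t] since [t >= 1]. *)
have := fft_cost_active (ltnW r_ge2) le_2r pb; have := fft_cost_sinks pb.
move: (k.+1 * _) (cost s) => x y; nia.
Qed.

(* Imported only here because classical_sets shadows finset names such as set0. *)
From mathcomp Require Import all_order all_algebra.
From mathcomp Require Import all_classical all_reals all_analysis.

Import Order.TTheory GRing.Theory Num.Theory.
Local Open Scope ring_scope.

(** * Passage to real logarithms *)

Theorem theorem6p9 (R : realType) :
  exists c : R, 0 < c /\
    forall m k r : nat, m = (2 ^ k)%N -> (2 <= m)%N -> (2 <= r)%N ->
      ((c * (m%:R * ln (m%:R) / ln (r%:R)))%:E
         <= OPT_PRBP R (@fft_edge k) r)%E.
Proof.
exists 28%:R^-1; split=> [|m [|k] r {m}-> // _ r_ge2].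
  by rewrite invr_gt0 ltr0n.
apply: le_ereal_inf_tmp => _ [s pb ->]; rewrite lee_fin.
have lnr_gt0 : 0 < ln (r%:R : R) by rewrite ln_gt0 // ltr1n.
rewrite mulrA ler_pdivrMr // ler_pdivrMl ?ltr0n //.
set m := (2 ^ k.+1)%N.
have m_gt0 : (0 < m)%N by rewrite expn_gt0.
(* For [r > m], multiplying [m <= 28 * cost s] by [ln m <= ln r] is enough. *)
have [le_rm|lt_mr] := leqP r m; last first.
  have le_ms : (m <= 28 * cost s)%N.
    by apply: leq_trans (fft_cost_sinks pb) (leq_pmull _ _).
  rewrite mulrA; apply: ler_pM.
  - exact: ler0n.
  - by rewrite ln_ge0 // ler1n.
  - by rewrite -natrM ler_nat.
  - have r_gt0 : (0 < r)%N by apply: ltn_trans lt_mr.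
    by rewrite ler_ln ?posrE ?ltr0n // ler_nat ltnW.
set t := trunc_log 2 r.
have ln2_gt0 : 0 < ln (2 : R) by rewrite ln_gt0 // ltr1n.
have le_t : t%:R * ln (2 : R) <= ln (r%:R : R).
  rewrite mulr_natl -lnXn ?ltr0n // ler_ln ?posrE ?exprn_gt0 ?ltr0n //; last lia.
  by rewrite -natrX ler_nat trunc_logP //; lia.
have := fft_cost_log (s := s) (k := k) (r := r); rewrite r_ge2 -/m -/t.
move=> /(_ le_rm pb) le_km.
have -> : ln (m%:R : R) = k.+1%:R * ln 2.
  by rewrite /m natrX lnXn ?ltr0n // mulr_natl.
rewrite mulrA -natrM mulrA -natrM.
(* The integer bound times [ln 2], as [ln m] is [k.+1] times [ln 2]; then [t * ln 2] is enlarged to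
   [ln r]. *)
apply: le_trans (_ : (28 * cost s)%:R * (t%:R * ln 2) <= _); last first.
  by rewrite ler_wpM2l.
by rewrite mulrA -natrM ler_pM2r // ler_nat mulnC.
Qed.
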